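(* Let $G=G_0$ be a finite simple graph and define recursively $G_n=G_{n-1}\times K_1$ for $n\ge1$. If $K_{d+1}$ is the largest clique in $G$, then $\dim(G_n)\to d$ as $n\to\infty$.
   Context: Unit sphere: for a vertex $x$ of a graph $G$, $S_G(x)$ is the subgraph induced on the neighbors of $x$. Dimension (inductive, rational-valued): $\dim(\emptyset)=-1$, and for a nonempty finite simple graph $G$ with vertex set $V$, $\dim(G)=1+\frac1{|V|}\sum_{x\in V}\dim(S_G(x))$. Refinement: $G\times K_1$ is (up to isomorphism) the graph whose vertices are the nonempty complete subgraphs (simplices) of $G$, two distinct ones being adjacent iff one is contained in the other. *)

(* Defs.v *)
From HB Require Import structures.
From mathcomp Require Import all_boot all_order all_algebra.

Set Implicit Arguments.
Unset Strict Implicit.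
Unset Printing Implicit Defensive.

Import Order.TTheory GRing.Theory Num.Theory.
Local Open Scope ring_scope.

Record sgraph := SGraph {
  svertex :> finType;
  sedge : rel svertex;
  sedge_sym : symmetric sedge;
  sedge_irr : irreflexive sedge }.

Section Induced.
Variables (G : sgraph) (A : {set G}).

Definition induced_edge : rel {x : G | x \in A} :=
  fun x y => sedge (val x) (val y).

Lemma induced_sym : symmetric induced_edge.
Proof. by move=> x y; apply: sedge_sym. Qed.

Lemma induced_irr : irreflexive induced_edge.
Proof. by move=> x; apply: sedge_irr. Qed.

Definition induced : sgraph := SGraph induced_sym induced_irr.
End Induced.

Definition unit_sphere (G : sgraph) (x : G) : sgraph :=
  induced [set y | sedge x y].

(* The natural number is only fuel for the recursion: the equations
   characterizing gdim are gdim_empty and gdimE below. *)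
Fixpoint gdim_rec (n : nat) (G : sgraph) : rat :=
  if n is m.+1 then
    if #|G| == 0%N then -1
    else 1 + #|G|%:R^-1 * \sum_(x : G) gdim_rec m (unit_sphere x)
  else -1.

Definition gdim (G : sgraph) : rat := gdim_rec #|G| G.

Lemma card_unit_sphere (G : sgraph) (x : G) : (#|unit_sphere x| < #|G|)%N.
Proof.
rewrite /= card_sig; apply: proper_card; apply/properP.
split; first exact/subsetP.
by exists x => //; rewrite !inE sedge_irr.
Qed.

Lemma gdim_rec_stable (m n : nat) (G : sgraph) :
  (#|G| <= m)%N -> (#|G| <= n)%N -> gdim_rec m G = gdim_rec n G.
Proof.
elim: m n G => [|m IHm] [|n] G //=; rewrite ?leqn0; try by move=> ? ->.
  by move=> ->.
move=> le_m le_n; case: ifP => // _; congr (_ + _ * _).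
apply: eq_bigr => x _; have lt_x := card_unit_sphere x.
by apply: IHm; rewrite -ltnS; apply: leq_trans lt_x _.
Qed.

Lemma gdim_empty (G : sgraph) : #|G| = 0%N -> gdim G = -1.
Proof. by rewrite /gdim => ->. Qed.

Lemma gdimE (G : sgraph) : (0 < #|G|)%N ->
  gdim G = 1 + #|G|%:R^-1 * \sum_(x : G) gdim (unit_sphere x).
Proof.
move=> G_gt0; rewrite /gdim -{1}(prednK G_gt0) /= -[X in X == _]prednK //=.
congr (_ + _ * _); apply: eq_bigr => x _; apply: gdim_rec_stable => //.
by rewrite -ltnS prednK //; apply: card_unit_sphere.
Qed.

Definition clique (G : sgraph) (A : {set G}) : bool :=
  [forall x in A, forall y in A, (x != y) ==> sedge x y].

(* The empty set is a clique, so the empty graph has clique number 0. *)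
Definition clique_number (G : sgraph) : nat :=
  \max_(A : {set G} | clique A) #|A|.

Section Refinement.
Variable G : sgraph.

Definition simplex : predArgType :=
  {A : {set G} | (A != set0) && clique A}.

Definition refinement_edge : rel simplex :=
  fun s t => (s != t) && ((val s \subset val t) || (val t \subset val s)).

Lemma refinement_sym : symmetric refinement_edge.
Proof. by move=> s t; rewrite /refinement_edge eq_sym orbC. Qed.

Lemma refinement_irr : irreflexive refinement_edge.
Proof. by move=> s; rewrite /refinement_edge eqxx. Qed.

(* This is G x K_1 up to isomorphism, with the simplices of G themselves as
   vertices. *)
Definition refinement : sgraph := SGraph refinement_sym refinement_irr.
End Refinement.

(* Main.v *)
(**
Call a clique short if it lies in a maximal clique with fewer than d+1
vertices. If all maximal cliques of a graph have d+1 vertices, then those of its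
unit spheres have d vertices, so by induction the graph has dimension d. Hence
the unit sphere of a vertex of G_n that is not short has dimension d-1, and
dim(G_n) falls below d by at most d times the proportion of short vertices.

A clique of G x K_1 is a chain of simplices of G, and it is short only if its
union s is. Among the chains with union s, exactly |s|! have length |s| and all
others are shorter. Weighting a clique A by M^|A| with M large, one refinement
therefore multiplies the total weight of the short cliques, which have at most
d vertices, by at most (3/2) d!, while it multiplies the number of (d+1)-cliques
by at least (d+1)! >= 2 d!. So the proportion of short vertices decays like
(3/4)^n.
*)
Require Import Defs.
From HB Require Import structures.
From mathcomp Require Import all_boot all_order all_algebra zify.

Set Implicit Arguments.
Unset Strict Implicit.
Unset Printing Implicit Defensive.

Import Order.TTheory GRing.Theory Num.Theory.

(** * Chains of nonempty sets, counted by their union *)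

Section Chains.
Variable T : finType.
Implicit Types (s t : {set T}) (D : {set {set T}}).

Definition chain D : bool :=
  (set0 \notin D) &&
  [forall A in D, forall B in D, (A \subset B) || (B \subset A)].

Lemma chainP D :
  reflect (set0 \notin D /\
           {in D &, forall A B : {set T}, (A \subset B) || (B \subset A)}) (chain D).
Proof.
apply: (iffP andP) => -[D0 totD]; split=> //.
  by move=> A B AD BD; move/forall_inP: totD => /(_ A AD) /forall_inP /(_ B BD).
by apply/forall_inP => A AD; apply/forall_inP => B BD; apply: totD.
Qed.

Lemma chainS D1 D2 : D1 \subset D2 -> chain D2 -> chain D1.
Proof.
move=> /subsetP D12 /chainP[D20 totD]; apply/chainP; split.
  by apply: contra D20; apply: D12.
by move=> A B /D12 AD /D12 BD; apply: totD.
Qed.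

Lemma chainU1 s D : s != set0 -> chain D -> cover D \subset s -> chain (s |: D).
Proof.
move=> s0 /chainP[D0 totD] /bigcupsP Ds; apply/chainP; split.
  by rewrite in_setU1 negb_or eq_sym s0.
move=> A B /setU1P[->|AD] /setU1P[->|BD]; first by rewrite subxx.
- by rewrite (Ds B BD) orbT.
- by rewrite (Ds A AD).
- exact: totD.
Qed.

(** A member of maximal cardinality contains all others, so it is the union. *)
Lemma cover_chain_in D : chain D -> cover D != set0 -> cover D \in D.
Proof.
move=> /chainP[_ totD] /set0Pn[x /bigcupP[A0 A0D _]].
have [A AD maxA] := @arg_maxnP _ A0 (mem D) (fun A : {set T} => #|A|) A0D.
suff -> : cover D = A by [].
apply/eqP; rewrite eqEsubset (bigcup_sup A) // andbT.
apply/bigcupsP => B BD; case/orP: (totD A B AD BD) => // AB.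
have := eqEcard A B; rewrite AB; have := maxA B BD; rewrite /= => -> /=.
by move/eqP ->.
Qed.

(** If not empty, the union of the remaining chain is one of its members, hence differs from the
    removed one. *)
Lemma cover_chainD1 D : chain D -> cover D != set0 ->
  cover (D :\ cover D) \proper cover D.
Proof.
move=> chD s0; rewrite properEneq; apply/andP; split; last first.
  by apply/bigcupsP => A /setD1P[_ AD]; apply: bigcup_sup AD.
have [->|t0] := eqVneq (cover (D :\ cover D)) set0; first by rewrite eq_sym.
have /setD1P[] // := cover_chain_in (chainS (subD1set D (cover D)) chD) t0.
Qed.

Lemma cover_chainU1 s D : cover D \subset s -> cover (s |: D) = s.
Proof.
move=> Ds; apply/eqP; rewrite eqEsubset (bigcup_sup s) ?setU11 // andbT.
apply/bigcupsP => A /setU1P[->//|AD].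
exact: subset_trans (bigcup_sup A AD) Ds.
Qed.

Lemma cover_chain0 D : chain D -> cover D = set0 -> D = set0.
Proof.
move=> /chainP[D0 _] cD0; apply/setP => A; rewrite inE; apply/negP => AD.
have : A \subset cover D by apply: bigcup_sup AD.
by rewrite cD0 subset0 => /eqP A0; rewrite -A0 AD in D0.
Qed.

Lemma card_chain D : chain D -> #|D| <= #|cover D|.
Proof.
have [n] := ubnP #|D|; elim: n D => // n IHn D; rewrite ltnS => leDn chD.
have [c0|s0] := eqVneq (cover D) set0.
  by rewrite (cover_chain0 chD c0) cards0.
have sD := cover_chain_in chD s0; rewrite (cardsD1 (cover D)) sD add1n in leDn *.
apply: leq_ltn_trans (proper_card (cover_chainD1 chD s0)).
exact/IHn/(chainS (subD1set D (cover D)) chD).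
Qed.

(** These are the complete flags of [s], the longest chains with union [s]. *)
Definition flags s : {set {set {set T}}} :=
  [set D | [&& chain D, cover D == s & #|D| == #|s|]].

(** Removing the top member [s] leaves a complete flag of a subset of [s] with one element less.
    There are [#|s|] such subsets, and induction counts the flags of each. *)
Lemma card_flags s : #|flags s| = (#|s|)`!.
Proof.
move: {2}#|s| (erefl #|s|) => n; elim: n s => [|n IHn] s cs.
  rewrite cs; have/eqP s0 := cs; rewrite cards_eq0 in s0; move/eqP: s0 => s0.
  rewrite (_ : flags s = [set set0]) ?cards1 //; apply/setP => D.
  rewrite !inE cs cards_eq0; apply/idP/idP => [/and3P[]//|/eqP ->].
  by rewrite s0 /cover big_set0 !eqxx !andbT; apply/chainP; split=> [|? ?]; rewrite inE.
have s0 : s != set0 by rewrite -cards_eq0 cs.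
pose P := [set B : {set T} | B \subset s & #|B| == n].
rewrite -sum1_card (partition_big (fun D => cover (D :\ s)) (mem P)) /=; last first.
  move=> D; rewrite !inE => /and3P[chD /eqP cD /eqP dD].
  have c0 : cover D != set0 by rewrite cD.
  have := cover_chainD1 chD c0; rewrite cD => ps; rewrite (proper_sub ps) /=.
  rewrite eqn_leq -ltnS -cs proper_card //=.
  have <- : #|D :\ s| = n.
    by move: dD; rewrite (cardsD1 s) -{1}cD cover_chain_in // cs add1n => -[].
  exact/card_chain/(chainS (subD1set D s) chD).
rewrite (eq_bigr (fun=> n`!)) => [|t].
  by rewrite sum_nat_const /P cards_draws cs binSn factS.
rewrite inE => /andP[ts /eqP ct]; rewrite -ct -IHn // -sum1_card.
rewrite (reindex_onto (fun D => s |: D) (fun D => D :\ s)) /=; last first.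
  move=> D; rewrite !inE => /andP[/and3P[chD /eqP cD _] _].
  by rewrite setD1K // -{1}cD cover_chain_in // cD.
apply: eq_bigl => D; apply/idP/idP.
  case/andP => /andP[fD cDs] /eqP DE; rewrite DE in cDs.
  move: fD; rewrite !inE cDs => /and3P[chD _ cD].
  rewrite (chainS (subsetUr [set s] D) chD) /=.
  by move: cD; rewrite cardsU1 -DE setD11 add1n cs eqSS ct.
rewrite !inE => /and3P[chD /eqP cD cardD].
have sD : s \notin D.
  apply/negP => sD; have : s \subset cover D by apply: bigcup_sup sD.
  by rewrite cD => /subset_leq_card; rewrite ct cs ltnn.
rewrite setU1K // cD !eqxx chainU1 ?cD //= cover_chainU1 ?cD // eqxx /=.
by rewrite cardsU1 sD cs add1n eqSS -ct cardD.
Qed.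

(* K bounds the number of families of subsets of s. Chains shorter than #|s| are
   weighted down by a factor 2 * K, so that together they contribute at most half
   of (2 * K) ^ #|s|. *)
Lemma sum_chains_le s d (K := 2 ^ 2 ^ d) : #|s| <= d ->
  2 * \sum_(D | chain D && (cover D == s)) (2 * K) ^ #|D|
    <= 3 * d`! * (2 * K) ^ #|s|.
Proof.
move=> sd; set M := 2 * K.
have K0 : 0 < K by rewrite expn_gt0.
have M0 : 0 < M by rewrite muln_gt0.
rewrite (bigID (fun D => #|D| == #|s|)) /= mulnDr.
have -> : 3 * d`! * M ^ #|s| = 2 * (d`! * M ^ #|s|) + d`! * M ^ #|s|.
  by rewrite -mulnA -[in LHS](addn1 2) mulnDl mul1n.
apply: leq_add.
  rewrite leq_mul2l /= (eq_bigr (fun=> M ^ #|s|)); last by move=> D /andP[_ /eqP ->].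
  rewrite (eq_bigl (mem (flags s))) => [|D]; last by rewrite !inE -andbA.
  by rewrite sum_nat_const card_flags leq_mul2r leq_fact ?orbT.
(* Here [#|D| < #|s|], so [M * M ^ #|D| <= M ^ #|s|], and at most [K] families are summed. *)
rewrite -(leq_pmul2l K0) mulnA [K * 2]mulnC -/M big_distrr /=.
apply: (@leq_trans (\sum_(D in powerset (powerset s)) M ^ #|s|)).
  rewrite big_mkcond [leqRHS]big_mkcond; apply: leq_sum => D _.
  case: ifP => // /andP[/andP[chD /eqP cD] cDs].
  rewrite ifT; last first.
    rewrite powersetE; apply/subsetP => A AD; rewrite powersetE -cD.
    exact: bigcup_sup AD.
  rewrite -expnS leq_pexp2l // ltn_neqAle cDs -cD; exact: card_chain.
rewrite sum_nat_const !card_powerset mulnCA.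
rewrite mulnA leq_mul2r; apply/orP; right.
apply: (@leq_trans K); last by rewrite leq_pmull ?fact_gt0.
by rewrite /K !leq_exp2l.
Qed.
End Chains.

(** * Short cliques and their weight *)

Section Cliques.
Variable G : sgraph.
Implicit Types (A B : {set G}) (x y : G).

Lemma cliqueP A :
  reflect {in A &, forall x y : G, x != y -> sedge x y} (clique A).
Proof.
apply: (iffP forall_inP) => [clA x y xA yA|clA x xA].
  by move/forall_inP: (clA x xA) => /(_ y yA) /implyP.
by apply/forall_inP => y yA; apply/implyP; apply: clA.
Qed.

Lemma cliqueS A B : A \subset B -> clique B -> clique A.
Proof.
move=> /subsetP AB /cliqueP clB; apply/cliqueP => x y /AB xB /AB yB.
exact: clB.
Qed.

Lemma clique1 x : clique [set x].
Proof. by apply/cliqueP => y z /set1P -> /set1P ->; rewrite eqxx. Qed.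

Definition short k A : bool :=
  [exists B, [&& maxset (@clique G) B, A \subset B & #|B| < k]].

Definition short_weight k M : nat := \sum_(A : {set G} | short k A) M ^ #|A|.

Definition nb_cliques k : nat := #|[set A : {set G} | clique A && (#|A| == k)]|.

Lemma short_clique k A : short k A -> clique A.
Proof. by case/existsP => B /and3P[/maxsetp clB AB _]; apply: cliqueS clB. Qed.

Lemma card_short k A : short k A -> #|A| < k.
Proof.
by case/existsP => B /and3P[_ AB]; apply: leq_ltn_trans; apply: subset_leq_card.
Qed.

Lemma card_short1 k M : 0 < M -> #|[set x | short k [set x]]| <= short_weight k M.
Proof.
move=> M0; rewrite -(card_imset _ (@set1_inj G)) -sum1_card /short_weight.
rewrite big_mkcond [leqRHS]big_mkcond; apply: leq_sum => A _.
case: ifP => // /imsetP[x]; rewrite inE => sx ->.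
by rewrite sx expn_gt0 M0.
Qed.

End Cliques.

(** * Cliques of the refinement as chains of simplices *)

Section RefinementCliques.
Variable G : sgraph.
Implicit Types (C : {set refinement G}) (D : {set {set G}}).

Definition simplices C : {set {set G}} := [set (val s : {set G}) | s in C].

Lemma card_simplices C : #|simplices C| = #|C|.
Proof. exact/card_imset/val_inj. Qed.

Lemma chain_simplices C : clique C -> chain (simplices C).
Proof.
move=> /cliqueP clC; apply/chainP; split.
  apply/imsetP => -[s _ s0]; have /andP[/eqP sn0 _] := valP s; exact: sn0.
move=> _ _ /imsetP[s sC ->] /imsetP[t tC ->].
have [->|st] := eqVneq s t; first by rewrite subxx.
by move: (clC s t sC tC st) => /= /andP[].
Qed.

Lemma clique_cover D :
  chain D -> {in D, forall A : {set G}, clique A} -> clique (cover D).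
Proof.
move=> /chainP[_ totD] clD; apply/cliqueP => x y /bigcupP[A AD xA] /bigcupP[B BD yB].
case/orP: (totD A B AD BD) => [/subsetP AB|/subsetP BA].
  by move/cliqueP: (clD B BD); apply=> //; apply: AB.
by move/cliqueP: (clD A AD); apply=> //; apply: BA.
Qed.

Lemma clique_simplices C : clique C -> clique (cover (simplices C)).
Proof.
move=> clC; apply: clique_cover; first exact: chain_simplices.
by move=> _ /imsetP[s sC ->]; have /andP[] := valP s.
Qed.

(** Subsets of the clique [cover D] are cliques, so all members of [D] are simplices. *)
Lemma simplices_surj D : chain D -> clique (cover D) ->
  exists2 C, clique C & simplices C = D.
Proof.
move=> /chainP[D0 totD] clD.
pose C : {set refinement G} := [set s | (val s : {set G}) \in D]; exists C.
  apply/cliqueP => s t; rewrite !inE => sD tD st.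
  by rewrite /= /refinement_edge st; apply: totD.
apply/setP => A; apply/imsetP/idP => [[s]|AD]; first by rewrite inE => sD ->.
have sA : (A != set0) && clique A.
  rewrite (cliqueS _ clD) ?andbT; last exact: bigcup_sup AD.
  by apply: contraNneq D0 => <-.
by exists (Sub A sA : simplex G) => //; rewrite inE.
Qed.

(** [simplices] is a bijection from the cliques of the refinement onto the chains whose union is a
    clique. *)
Lemma sum_clique_refinement (F : {set {set G}} -> nat) :
  \sum_(C | clique C) F (simplices C)
    = \sum_(D | chain D && clique (cover D)) F D.
Proof.
rewrite -big_imset /=; last first.
  by move=> C1 C2 _ _; apply/imset_inj/val_inj.
apply: eq_bigl => D; apply/imsetP/andP => [[C clC ->]|[chD clD]].
  by split; [exact: chain_simplices | exact: clique_simplices].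
by have [C clC <-] := simplices_surj chD clD; exists C.
Qed.

(** Each clique with [k] vertices is the union of exactly [k!] chains of length [k], its complete
    flags. *)
Lemma nb_cliques_refinement k :
  k`! * nb_cliques G k <= nb_cliques (refinement G) k.
Proof.
rewrite /nb_cliques mulnC -sum_nat_const -[leqRHS]sum1_card.
rewrite (eq_bigl (fun C => clique C && (#|C| == k))); last by move=> C; rewrite inE.
rewrite big_mkcondr /= (eq_bigr (fun C => (#|simplices C| == k) : nat)); last first.
  by move=> C _; rewrite card_simplices; case: eqP.
rewrite (sum_clique_refinement (fun D => (#|D| == k) : nat)).
rewrite (partition_big (@cover G) predT) //=.
rewrite big_mkcond; apply: leq_sum => A _; case: ifP => //.
rewrite inE => /andP[clA /eqP cA]; rewrite -cA -card_flags -sum1_card.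
rewrite big_mkcond [leqRHS]big_mkcond; apply: leq_sum => D _.
by rewrite inE; case: ifP => // /and3P[-> /eqP -> ->]; rewrite clA eqxx.
Qed.

(** A clique larger than the union could be put on top of the chain; and a maximal chain has no
    gaps, so it has a member for each element of its union. *)
Lemma maxset_simplices C (D := simplices C) : maxset (@clique (refinement G)) C ->
  maxset (@clique G) (cover D) /\ #|cover D| <= #|D|.
Proof.
move=> maxC; have clC := maxsetp maxC.
have clD : clique (cover D) by apply: clique_simplices.
have chD : chain D by apply: chain_simplices.
have /chainP[D0 totD] := chD.
(* Maximality of [C], restated for chains whose union is a clique. *)
have maxD E : chain E -> clique (cover E) -> D \subset E -> E = D.
  move=> chE clE; have [C' clC' <-] := simplices_surj chE clE => sDE.
  congr (simplices _); apply: (maxsetsup maxC) => //; apply/subsetP => s sC.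
  have : val s \in simplices C' by apply: (subsetP sDE); apply: imset_f.
  by case/imsetP => t tC' /val_inj ->.
split.
  apply/maxsetP; split=> // B clB sDB.
  have [B0|B0] := eqVneq B set0.
    by move: sDB; rewrite B0 subset0 => /eqP ->.
  have DE : B |: D = D.
    apply: maxD; rewrite ?subsetUr ?cover_chainU1 //.
    exact: chainU1.
  by rewrite -{1}(cover_chainU1 sDB) DE.
(* Z y can be inserted into the chain D, so it belongs to D by maximality. If
   Z y = Z z with y != z, then some element of D contains y but not z and another
   one z but not y, so these two are not comparable. *)
pose Z y := y |: \bigcup_(A in D | y \notin A) A.
have ZD y : y \in cover D -> Z y \in D.
  move=> yD.
  have sZD : Z y \subset cover D.
    rewrite subUset sub1set yD /=; apply/bigcupsP => A /andP[AD _].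
    exact: bigcup_sup AD.
  have DE : Z y |: D = D.
    apply: maxD; rewrite ?subsetUr //; last first.
      apply: cliqueS clD; apply/bigcupsP => A /setU1P[->//|AD].
      exact: bigcup_sup AD.
    apply/chainP; split.
      rewrite in_setU1 negb_or D0 andbT eq_sym; apply/set0Pn; exists y.
      exact: setU11.
    have cmp A : A \in D -> (A \subset Z y) || (Z y \subset A).
      move=> AD; case: (boolP (y \in A)) => yA; apply/orP; [right|left].
        rewrite subUset sub1set yA /=; apply/bigcupsP => B /andP[BD yB].
        case/orP: (totD A B AD BD) => // /subsetP AB.
        by rewrite AB in yB.
      by apply/subsetU/orP; right; apply: (bigcup_sup A); rewrite AD.
    move=> A B /setU1P[->|AD] /setU1P[->|BD]; first by rewrite subxx.
    - by rewrite orbC cmp.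
    - by rewrite cmp.
    - exact: totD.
  by rewrite -DE setU11.
have Zinj : {in cover D &, injective Z}.
  move=> y z _ _ eqZ; apply/eqP/negPn/negP => yz.
  have : y \in Z z by rewrite -eqZ setU11.
  rewrite in_setU1 (negPf yz) => /bigcupP[A /andP[AD zA] yA].
  have : z \in Z y by rewrite eqZ setU11.
  rewrite in_setU1 eq_sym (negPf yz) => /bigcupP[B /andP[BD yB] zB].
  case/orP: (totD A B AD BD) => /subsetP AB.
    by rewrite AB in yB.
  by rewrite AB in zA.
rewrite -(card_in_imset Zinj); apply/subset_leq_card/subsetP.
by move=> _ /imsetP[y yD ->]; apply: ZD.
Qed.

(** A small maximal clique containing [C] has a union that is maximal and no larger. *)
Lemma short_simplices k C : short k C -> short k (cover (simplices C)).
Proof.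
case/existsP => C' /and3P[maxC' sCC' cC'].
have [maxD leD] := maxset_simplices maxC'.
apply/existsP; exists (cover (simplices C')); rewrite maxD /=.
rewrite (leq_ltn_trans leD) ?card_simplices // andbT.
apply/bigcupsP => A /(subsetP (imsetS _ sCC')) AD.
exact: bigcup_sup AD.
Qed.

Lemma short_weight_refinement d (M := 2 * 2 ^ 2 ^ d) :
  2 * short_weight (refinement G) d.+1 M <= 3 * d`! * short_weight G d.+1 M.
Proof.
apply: (@leq_trans (2 * \sum_(D | chain D && short d.+1 (cover D)) M ^ #|D|)).
  rewrite leq_mul2l /=.
  (* Shortness of the union becomes part of the summand, so that the sum over all cliques can be
     transported to chains. *)
  pose F D := if short d.+1 (cover D) then M ^ #|D| else 0.
  apply: (@leq_trans (\sum_(C | clique C) F (simplices C))).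
    rewrite /short_weight big_mkcond [leqRHS]big_mkcond; apply: leq_sum => C _.
    case: ifP => // sC; rewrite (short_clique sC) /F (short_simplices sC).
    by rewrite card_simplices.
  rewrite sum_clique_refinement -big_mkcondr /= leq_eqVlt; apply/orP; left.
  apply/eqP/eq_bigl => D; case: (boolP (short _ _)) => [/short_clique ->|]; rewrite ?andbF //.
  by rewrite !andbT.
rewrite (partition_big (@cover G) (short d.+1)) /=; last by move=> D /andP[].
rewrite /short_weight !big_distrr; apply: leq_sum => A sA.
rewrite (eq_bigl (fun D => chain D && (cover D == A))); last first.
  by move=> D; case: eqP => [->|]; rewrite ?andbF // sA andbT.
by apply: sum_chains_le; rewrite -ltnS; apply: card_short.
Qed.

Lemma card_refinement k : nb_cliques G k.+1 <= #|refinement G|.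
Proof.
rewrite /nb_cliques card_sig; apply: subset_leq_card; apply/subsetP => A.
rewrite !inE => /andP[-> /eqP cA]; rewrite andbT -cards_eq0 cA //.
Qed.

(** A chain has at most as many members as its union has elements. *)
Lemma clique_number_refinement : clique_number (refinement G) <= clique_number G.
Proof.
apply/bigmax_leqP => C clC; rewrite -card_simplices.
apply: leq_trans (card_chain (chain_simplices clC)) _.
exact/leq_bigmax_cond/clique_simplices.
Qed.

End RefinementCliques.

(** * Cliques of a unit sphere as cliques through its center *)

Section UnitSphere.
Variables (G : sgraph) (x : G).
Implicit Types (A : {set unit_sphere x}) (B : {set G}).

Definition cone A : {set G} := x |: [set val y | y in A].

Lemma card_cone A : #|cone A| = #|A|.+1.
Proof.
rewrite cardsU1 (card_imset _ val_inj) (_ : x \notin _) //.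
apply/imsetP => -[y _ xy]; have := valP y.
by rewrite -xy inE sedge_irr.
Qed.

Lemma clique_cone A : clique A -> clique (cone A).
Proof.
move=> /cliqueP clA; apply/cliqueP => y z.
have adjx (w : unit_sphere x) : sedge x (val w) by have := valP w; rewrite inE.
move=> /setU1P[->|/imsetP[y' yA ->]] /setU1P[->|/imsetP[z' zA ->]].
- by rewrite eqxx.
- by rewrite adjx.
- by rewrite sedge_sym adjx.
- by rewrite (inj_eq val_inj) => /(clA y' z' yA zA).
Qed.

Lemma cone_surj B : clique B -> x \in B -> exists2 A, clique A & cone A = B.
Proof.
move=> /cliqueP clB xB.
pose A : {set unit_sphere x} := [set y | val y \in B]; exists A.
  apply/cliqueP => y z; rewrite !inE => yB zB yz.
  by apply: clB; rewrite ?(inj_eq val_inj).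
apply/setP => y; rewrite in_setU1; have [->//|yx /=] := eqVneq y x.
apply/imsetP/idP => [[z]|yB]; first by rewrite inE => zB ->.
have xy : y \in [set y | sedge x y] by rewrite inE clB // eq_sym.
by exists (Sub y xy : unit_sphere x) => //; rewrite inE.
Qed.

(** A clique containing [cone A] contains [x], so it is itself the cone of a clique of the unit
    sphere. *)
Lemma maxset_cone A :
  maxset (@clique (unit_sphere x)) A -> maxset (@clique G) (cone A).
Proof.
move=> maxA; apply/maxsetP; split; first exact/clique_cone/(maxsetp maxA).
move=> B clB sAB; have xB : x \in B by apply: (subsetP sAB); apply: setU11.
have [A' clA' BE] := cone_surj clB xB; rewrite -BE in sAB *.
congr cone; apply: (maxsetsup maxA) => //; apply/subsetP => y yA.
have : val y \in cone A' by apply/(subsetP sAB)/setU1P; right; apply: imset_f.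
case/setU1P => [yx|/imsetP[z zA' /val_inj ->] //].
by have := valP y; rewrite yx inE sedge_irr.
Qed.

End UnitSphere.

(** * Bounds on the dimension from clique sizes *)

Section DimensionBounds.
Local Open Scope ring_scope.

Lemma gdim_geN1 (G : sgraph) : -1 <= gdim G.
Proof.
have [n] := ubnP #|G|; elim: n G => // n IHn G; rewrite ltnS => leGn.
case: (posnP #|G|) => [/gdim_empty -> //|G0]; rewrite gdimE // -lerBlDl.
rewrite mulrC ler_pdivlMr ?ltr0n //.
apply: (@le_trans _ _ (\sum_(x : G) -1)); last first.
  by apply: ler_sum => x _; apply/IHn/(leq_trans (card_unit_sphere x)).
by rewrite sumr_const -[leRHS]mulr_natr ler_pM2r ?ltr0n.
Qed.

(** Coning adds a vertex to a clique, so the clique number of a unit sphere is smaller by at least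
    one; then average over the spheres. *)
Lemma gdim_le (G : sgraph) k : (clique_number G <= k)%N -> gdim G <= k%:R - 1.
Proof.
elim: k G => [|k IHk] G clk; case: (posnP #|G|) => [/gdim_empty ->|G0].
- by rewrite sub0r.
- have /card_gt0P[x _] := G0.
  have : (#|[set x]| <= clique_number G)%N by exact/leq_bigmax_cond/clique1.
  by move/leq_trans/(_ clk); rewrite cards1.
- by rewrite -[X in X <= _]sub0r lerB.
rewrite gdimE // mulrSr addrK -lerBrDl mulrC ler_pdivrMr ?ltr0n //.
apply: (@le_trans _ _ (\sum_(x : G) (k%:R - 1))); last first.
  by rewrite sumr_const -[leLHS]mulr_natr.
apply: ler_sum => x _; apply: IHk; apply/bigmax_leqP => A clA.
rewrite -ltnS -card_cone; apply: leq_trans clk.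
exact/leq_bigmax_cond/clique_cone.
Qed.

Lemma gdim_ge_maxset (G : sgraph) k :
  (forall A, maxset (@clique G) A -> k <= #|A|)%N -> k%:R - 1 <= gdim G.
Proof.
elim: k G => [|k IHk] G pureG; first by rewrite sub0r gdim_geN1.
(* A maximal clique exists and has at least [k + 1] vertices, so [G] is not empty. *)
have cl0 : clique (set0 : {set G}) by apply/cliqueP => x y; rewrite inE.
have [A maxA _] := maxset_exists cl0.
have G0 : (0 < #|G|)%N.
  exact: leq_trans (leq_trans (pureG A maxA) (max_card (mem A))).
rewrite gdimE // mulrSr addrK -lerBlDl mulrC ler_pdivlMr ?ltr0n //.
apply: (@le_trans _ _ (\sum_(x : G) (k%:R - 1))).
  by rewrite sumr_const -[leRHS]mulr_natr.
apply: ler_sum => x _; apply: IHk => B maxB.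
by rewrite -ltnS -card_cone; apply/pureG/maxset_cone.
Qed.

(** The sphere of a vertex that is not short has dimension at least [k - 1]. That of a short vertex
    has dimension at least [-1], a loss of at most [k]. *)
Lemma gdim_deficit (G : sgraph) k : (0 < #|G|)%N ->
  k%:R - gdim G <= k%:R * (#|[set x : G | short k.+1 [set x]]|%:R / #|G|%:R).
Proof.
move=> G0; set b := #|_|; have n0 : 0 < #|G|%:R :> rat by rewrite ltr0n.
rewrite mulrA ler_pdivlMr // mulrBl lerBlDl -lerBlDr gdimE //.
rewrite mulrDl mul1r [_^-1 * _]mulrC divfK ?gt_eqF // -lerBlDl.
apply: (@le_trans _ _ (\sum_(x : G) ((k%:R - 1) - k%:R *+ short k.+1 [set x]))).
  rewrite sumrB sumr_const sumrMnr -[_ *+ #|_|]mulr_natr -[_ *+ \sum_i _]mulr_natr.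
  rewrite mulrBl mul1r addrAC lerB // ler_wpM2l // ler_nat /b.
  by rewrite -sum1_card [leqRHS]big_mkcond; apply: leq_sum => x _; rewrite inE; case: ifP.
apply: ler_sum => x _; case: (boolP (short _ _)) => [_|].
  by rewrite mulr1n addrAC subrr sub0r gdim_geN1.
rewrite mulr0n subr0 => nsx; apply: gdim_ge_maxset => A maxA.
rewrite -ltnS -card_cone leqNgt; apply: contra nsx => ltA.
by apply/existsP; exists (cone A); rewrite maxset_cone // sub1set setU11.
Qed.

End DimensionBounds.

(** * Geometric decay under iterated refinement *)

Section Iterate.
Variable G : sgraph.
Local Notation G_ n := (iter n refinement G).

Lemma clique_number_iter n : (clique_number (G_ n) <= clique_number G).
Proof. by elim: n => // n; apply/leq_trans/clique_number_refinement. Qed.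

Lemma nb_cliques_iter_gt0 n : (0 < nb_cliques (G_ n) (clique_number G)).
Proof.
elim: n => [|n IHn]; last first.
  by apply: leq_trans (nb_cliques_refinement _ _); rewrite muln_gt0 fact_gt0.
have cl0 : clique (set0 : {set G}) by apply/cliqueP => x y; rewrite inE.
have [|A clA cA] := @eq_bigmax_cond _ (@clique G) (fun A : {set G} => #|A|).
  by apply/card_gt0P; exists set0.
apply/card_gt0P; exists A; rewrite inE; apply/andP; split=> //.
by rewrite -cA eqxx.
Qed.

(** The ratio of the short weight to the number of [(d+1)]-cliques shrinks by [3/4] at each step;
    the inequality is cross-multiplied to stay in [nat]. *)
Lemma short_weight_iter d (M := 2 * 2 ^ 2 ^ d) n : 0 < d ->
  4 ^ n * short_weight (G_ n) d.+1 M * nb_cliques G d.+1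
    <= 3 ^ n * short_weight G d.+1 M * nb_cliques (G_ n) d.+1.
Proof.
move=> d0; elim: n => [|n IHn]; first by rewrite !expn0.
have := nb_cliques_refinement (G_ n) d.+1.
have := short_weight_refinement (G_ n) d; rewrite /= -/M.
rewrite !expnS factS; move: IHn.
set W := short_weight (G_ n) _ _; set W1 := short_weight (refinement _) _ _.
set F := nb_cliques (G_ n) _; set F1 := nb_cliques (refinement _) _.
set F0 := nb_cliques G _; set W0 := short_weight G _ _.
set f := d`!; set a := 4 ^ n; set b := 3 ^ n => IHn leW leF.
(* [(d+1)! >= 2 * d!] holds since [d > 0]. *)
have le2F : 2 * f * F <= F1.
  by apply: leq_trans leF; rewrite !leq_mul2r ltnS d0 !orbT.
apply: (@leq_trans (2 * a * F0 * (2 * W1))); first by lia.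
apply: (@leq_trans (2 * a * F0 * (3 * f * W))); first by rewrite leq_mul2l leW orbT.
apply: (@leq_trans (6 * f * (b * W0 * F))); last first.
  apply: (@leq_trans (3 * b * W0 * (2 * f * F))); first by lia.
  by rewrite leq_mul2l le2F orbT.
apply: (@leq_trans (6 * f * (a * W * F0))); first by lia.
by rewrite leq_mul2l IHn orbT.
Qed.

(** The index is [n.+1] because the vertices of a refinement are simplices: the [(d+1)]-cliques of
    [G_ n] bound their number from below. *)
Lemma gdim_refinement_ge d : clique_number G = d.+1 ->
  exists C : rat, forall n, (d%:R - C * (3 / 4) ^+ n <= gdim (G_ n.+1))%R.
Proof.
move=> cG; set M := 2 * 2 ^ 2 ^ d.
pose W0 := short_weight G d.+1 M; pose F0 := nb_cliques G d.+1.
(* The factor [d] comes from [gdim_deficit], [3 * d! / 2] from the last refinement, and [W0 / F0] is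
   the initial ratio. *)
exists (d%:R * ((3 * d`! * W0)%:R / (2 * F0)%:R))%R => n.
have F_gt0 m : 0 < nb_cliques (G_ m) d.+1 by rewrite -cG nb_cliques_iter_gt0.
have leV := card_refinement (G_ n) d; rewrite -iterS in leV.
have V_gt0 := leq_trans (F_gt0 n) leV.
have F0_gt0 : 0 < F0 := F_gt0 0.
rewrite lerBlDr -lerBlDl; apply: le_trans (gdim_deficit d V_gt0) _.
(* For [d = 0], where the decay estimate does not apply, the bound on the deficit is already
   zero. *)
rewrite -mulrA; case: (posnP d) => [->|d0]; first by rewrite !mul0r.
apply: ler_wpM2l => //; set b := #|_|; set V := #|_| in V_gt0 *.
have leb : b <= short_weight (G_ n.+1) d.+1 M by rewrite card_short1 ?muln_gt0 ?expn_gt0.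
rewrite expr_div_n mulf_div -!natrX -!natrM ler_pdivlMr; last first.
  by rewrite ltr0n !muln_gt0 expn_gt0 F0_gt0.
rewrite mulrAC ler_pdivrMr ?ltr0n // -!natrM ler_nat.
have := short_weight_refinement (G_ n) d; have := short_weight_iter n d0.
rewrite -/M -/W0 -/F0 -iterS => leW leW1.
apply: (@leq_trans (4 ^ n * F0 * (2 * short_weight (G_ n.+1) d.+1 M))).
  rewrite (_ : _ * _ = 4 ^ n * F0 * (2 * b)); first by rewrite !leq_mul2l leb !orbT.
  by lia.
apply: leq_trans (_ : 4 ^ n * F0 * (3 * d`! * short_weight (G_ n) d.+1 M) <= _).
  by rewrite leq_mul2l leW1 orbT.
apply: (@leq_trans (3 * d`! * (3 ^ n * W0 * V))); last by lia.
apply: leq_trans (_ : 3 * d`! * (3 ^ n * W0 * nb_cliques (G_ n) d.+1) <= _).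
  rewrite (_ : _ * _ = 3 * d`! * (4 ^ n * short_weight (G_ n) d.+1 M * F0)); last by lia.
  by rewrite leq_mul2l leW orbT.
by rewrite !leq_mul2l leV !orbT.
Qed.

End Iterate.

(* Imported last because classical_sets shadows names of finset. *)
From mathcomp Require Import all_classical all_reals all_analysis.

(** * Convergence in the reals *)

Import numFieldNormedType.Exports.
Local Open Scope classical_set_scope.
Local Open Scope ring_scope.

(** [d] is an integer so as to include the empty graph, where it is [-1]. *)
Theorem proposition13 (R : realType) (G : sgraph) (d : int)
    (hd : (clique_number G)%:Z = d + 1) :
  (ratr (gdim (iter n refinement G)) : R) @[n --> \oo] --> (d%:~R : R).
Proof.
have dE : d%:~R = (clique_number G)%:R - 1 :> rat.
  by rewrite -[RHS]addrC -[_%:R]/((clique_number G)%:Z%:~R) hd rmorphD /= addrC addrK.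
have [C leC] : exists C : rat, forall n,
    d%:~R - C * (3 / 4) ^+ n <= gdim (iter n.+1 refinement G).
  case cG : (clique_number G) dE => [|c] ->; last first.
    by rewrite mulrSr addrK; apply: gdim_refinement_ge.
  (* Clique number 0: the general bound [-1 <= gdim] is the claim, without error term. *)
  by exists 0 => n; rewrite mul0r subr0 sub0r gdim_geN1.
have leD n : gdim (iter n refinement G) <= d%:~R.
  by rewrite dE; apply/gdim_le/clique_number_iter.
(* The lower bound only concerns the graphs after at least one refinement. *)
rewrite -cvg_shiftS /=.
apply: (@squeeze_cvgr _ _ _ _ (fun n => d%:~R - ratr C * (3 / 4) ^+ n) (fun=> d%:~R)).
- near=> n; rewrite -[d%:~R](ratr_int R) ler_rat (leD n.+1) andbT.
  have -> : ratr d%:~R - ratr C * (3 / 4) ^+ n = ratr (d%:~R - C * (3 / 4) ^+ n) :> R.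
    by rewrite rmorphB rmorphM rmorphXn /= fmorph_div /= !ratr_nat.
  by rewrite ler_rat; apply: leC.
- rewrite -[X in _ --> X]subr0; apply: cvgB; first exact: cvg_cst.
  rewrite -(mulr0 (ratr C)); apply: cvgM; first exact: cvg_cst.
  by apply: cvg_expr; rewrite ger0_norm ?divr_ge0 // ltr_pdivrMr // mul1r ltr_nat.
- exact: cvg_cst.
Unshelve. all: by end_near. Qed.
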